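(* Let $k,l\ge2$, $n\ge1$ be integers, $B>0$, and suppose $f:\mathbb{Z}_k^n\to\mathbb{Z}_l$ satisfies $$\sum_{j=1}^n\mathbb{E}_x\big[|f(x)-f(x\oplus e_j)|'\big]\le B,$$ where $x$ is uniform on $\mathbb{Z}_k^n$. Then for any $\epsilon>0$ there exists an $M$-junta $g:\mathbb{Z}_k^n\to\mathbb{Z}_l$ such that $f$ is $\epsilon$-close to $g$ and $$M\le l\exp\!\left(\frac{C_2Bk}{\epsilon}\right),$$ where $C_2$ is an absolute constant.
   Context: For $s\in\mathbb{Z}_l$, $|s|'$ denotes the cyclic distance from $s$ to $0$ in $\mathbb{Z}_l$. $e_j$ is the $j$th unit vector of $\mathbb{Z}_k^n$ and $\oplus$ is addition modulo $k$. Two functions $h,\tilde h:\mathbb{Z}_k^n\to\mathbb{Z}_l$ are $\epsilon$-close if $k^{-n}\sum_{x\in\mathbb{Z}_k^n}|h(x)-\tilde h(x)|'\le\epsilon$. A function $g$ on $\mathbb{Z}_k^n$ is an $M$-junta if there is $J\subset[n]$ with $|J|=M$ such that $g(x)$ depends only on $(x_j)_{j\in J}$. *)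

(* Defs.v *)
From HB Require Import structures.
From mathcomp Require Import all_boot all_order all_algebra.
From mathcomp Require Import reals.

Set Implicit Arguments.
Unset Strict Implicit.
Unset Printing Implicit Defensive.

Import Order.TTheory GRing.Theory Num.Theory.
Local Open Scope ring_scope.

(* Throughout, Z_k^n is the type 'rV['Z_k]_n of row vectors over 'Z_k, so that
   x + delta_mx 0 j adds the j-th unit vector modulo k.  As 'Z_k is the ring of
   integers mod k only for k >= 2, these definitions are meant for k, l >= 2. *)

(* The residue s is represented by its canonical value in {0, ..., l-1}. *)
Definition cyc_abs (l : nat) (s : 'Z_l) : nat := minn s (l - s).

Definition mean (R : realType) (k n : nat) (F : 'rV['Z_k]_n -> R) : R :=
  (k%:R ^+ n)^-1 * \sum_(x : 'rV['Z_k]_n) F x.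

Definition eps_close (R : realType) (k l n : nat) (eps : R)
    (h h' : 'rV['Z_k]_n -> 'Z_l) : Prop :=
  mean (fun x => (cyc_abs (h x - h' x))%:R) <= eps.

Definition is_junta (k l n M : nat) (g : 'rV['Z_k]_n -> 'Z_l) : Prop :=
  exists J : {set 'I_n}, #|J| = M /\
    forall x y : 'rV['Z_k]_n,
      (forall j, j \in J -> x 0 j = y 0 j) -> g x = g y.

(* Main.v *)
Require Import Defs.
From HB Require Import structures.
From mathcomp Require Import all_boot all_order all_algebra.
From mathcomp Require Import reals sequences exp.
From mathcomp Require Import zify ring lra.

Set Implicit Arguments.
Unset Strict Implicit.
Unset Printing Implicit Defensive.

Import Order.TTheory GRing.Theory Num.Theory.
Local Open Scope ring_scope.

(* The indicators of the half-circles of Z_l embed the cyclic distance as half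
   of a squared Euclidean distance, which reduces the problem to Friedgut's
   junta argument for a family of Boolean functions whose influences are summed
   over the family.  To lose only a factor k, and no log k, in the total
   influence, Z_k^n is replaced by a discrete cube: N bits, read as an integer
   v < 2^N, encode the cell v k / 2^N of Z_k.  Flipping the bit of weight 2^b
   moves v by 2^b, so it crosses a given boundary between two cells with
   probability at most 2 2^b / 2^N, and these probabilities add up to a constant
   over b.  On the cube, the Fourier mass outside the influential coordinates is
   bounded by the total influence at high levels, and by Bonami's inequality at
   low levels.  Finally the remaining coordinates are frozen at their best
   value. *)

(** * Averages over finite types *)

Section Expectation.
Variable R : realFieldType.

Definition expect (T : finType) (F : T -> R) : R := #|T|%:R^-1 * \sum_x F x.

Variable T : finType.
Implicit Types F G : T -> R.

Lemma eq_expect F G : F =1 G -> expect F = expect G.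
Proof. by move=> eqFG; congr (_ * _); apply: eq_bigr. Qed.

Lemma expectD F G : expect (fun x => F x + G x) = expect F + expect G.
Proof. by rewrite /expect big_split mulrDr. Qed.

Lemma expectZ c F : expect (fun x => c * F x) = c * expect F.
Proof. by rewrite /expect -mulr_sumr mulrCA. Qed.

Lemma expect_sum (K : finType) (P : pred K) (F : K -> T -> R) :
  expect (fun x => \sum_(i | P i) F i x) = \sum_(i | P i) expect (F i).
Proof. by rewrite /expect exchange_big mulr_sumr. Qed.

Lemma expect_ge0 F : (forall x, 0 <= F x) -> 0 <= expect F.
Proof. by move=> F0; rewrite mulr_ge0 ?invr_ge0 ?ler0n ?sumr_ge0. Qed.

Lemma ler_expect F G : (forall x, F x <= G x) -> expect F <= expect G.
Proof. by move=> leFG; rewrite ler_wpM2l ?invr_ge0 ?ler0n ?ler_sum. Qed.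

Lemma expect_reindex (h : T -> T) F :
  injective h -> expect (fun x => F (h x)) = expect F.
Proof. by move=> h_inj; rewrite /expect [in RHS](reindex_inj h_inj). Qed.

Lemma expect_cst c : (0 < #|T|)%N -> expect (fun _ : T => c) = c.
Proof.
move=> T0; rewrite /expect sumr_const -[c *+ _]mulr_natl.
by rewrite mulKf // pnatr_eq0 -lt0n.
Qed.

Lemma exists_le_expect F (t0 : T) :
  exists t, F t <= expect F.
Proof.
case: (Order.TotalTheory.arg_minP F (erefl : xpredT t0)) => t _ F_min; exists t.
rewrite -[leLHS]expect_cst; last by apply/card_gt0P; exists t0.
by apply: ler_expect => u; apply: F_min.
Qed.

Lemma cauchy_schwarz F G :
  expect (fun x => F x * G x) ^+ 2 <=
  expect (fun x => F x ^+ 2) * expect (fun x => G x ^+ 2).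
Proof.
(* Lagrange's identity. *)
rewrite /expect exprMn [leRHS]mulrACA -expr2 ler_wpM2l ?sqr_ge0 //.
have : 0 <= \sum_x \sum_y (F x * G y - F y * G x) ^+ 2.
  by apply: sumr_ge0 => x _; apply: sumr_ge0 => y _; apply: sqr_ge0.
have -> : \sum_x \sum_y (F x * G y - F y * G x) ^+ 2 =
  2 * ((\sum_x F x ^+ 2) * (\sum_x G x ^+ 2) - (\sum_x F x * G x) ^+ 2).
  under eq_bigr => x _.
    under eq_bigr => y _.
      have -> : (F x * G y - F y * G x) ^+ 2 = F x ^+ 2 * G y ^+ 2
        + G x ^+ 2 * F y ^+ 2 + (- 2 * (F x * G x)) * (F y * G y) by ring.
      over.
    rewrite !big_split /= -!mulr_sumr; over.
  rewrite !big_split /= -!mulr_suml -mulr_sumr; ring.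
by rewrite pmulr_rge0 // subr_ge0.
Qed.

End Expectation.

Lemma exchange_expect (R : realFieldType) (X Y : finType) (F : X -> Y -> R) :
  expect (fun x => expect (F x)) = expect (fun y => expect (F^~ y)).
Proof. by rewrite /expect -!mulr_sumr mulrCA exchange_big. Qed.

(** An involution permutes the pairs, so the first component of a uniform pair stays uniform after
    [s]. Each use takes for [s] an exchange of coordinates between the two components. *)
Lemma expect_swap (R : realFieldType) (X T : finType) (s : X * T -> X * T)
    (G : X -> R) : involutive s -> (0 < #|T|)%N ->
  expect (fun x => expect (fun t => G (s (x, t)).1)) = expect G.
Proof.
move=> sK T0; rewrite /expect.
rewrite -mulr_sumr pair_big /= (reindex_inj (can_inj sK)) /=.
under eq_bigr => p _ do rewrite -surjective_pairing sK.
rewrite -(pair_bigA _ (fun x _ => G x)) /=.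
under eq_bigr do rewrite sumr_const -mulr_natl.
by rewrite -mulr_sumr mulKf // pnatr_eq0 -lt0n.
Qed.

(** * Fourier analysis and influences on the discrete cube *)

Section Cube.
Variables (R : realFieldType) (I : finType).
Notation cube := {ffun I -> bool}.
Implicit Types (f g h : cube -> R) (S A J : {set I}) (x y : cube) (i j : I).

Definition flip i x : cube := [ffun j => x j (+) (j == i)].

Definition splice J x y : cube := [ffun j => if j \in J then x j else y j].

Definition chi S x : R := \prod_(i in S) (-1) ^+ x i.

Definition coef f S : R := expect (fun x => f x * chi S x).

(** For a 0/1-valued [f], the probability that flipping bit [i] changes [f]. *)
Definition influence f i : R := expect (fun x => (f x - f (flip i x)) ^+ 2).

Lemma flipK i : involutive (flip i).
Proof. by move=> x; apply/ffunP => j; rewrite !ffunE -addbA addbb addbF. Qed.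

Lemma chi_flip S i x : chi S (flip i x) = (-1) ^+ (i \in S) * chi S x.
Proof.
have eqD j : j != i -> flip i x j = x j.
  by rewrite ffunE => /negPf->; rewrite addbF.
rewrite /chi; have [iS|iS] := boolP (i \in S).
  rewrite !(bigD1 i iS) /= ffunE eqxx addbT signrN mulN1r mulNr.
  by congr (- (_ * _)); apply: eq_bigr => j /andP[_ /eqD->].
rewrite mul1r; apply: eq_bigr => j jS; rewrite eqD //.
by apply: contraNneq iS => <-.
Qed.

Lemma card_cube_neq0 : #|{: cube}|%:R != 0 :> R.
Proof. by rewrite card_ffun card_bool pnatr_eq0 expn_eq0. Qed.

Lemma card_cube_gt0 : (0 < #|{: cube}|)%N.
Proof. by rewrite card_ffun card_bool expn_gt0. Qed.

(** The sum over [S] expands the product over [i] of 1 + (-1)^(x_i + y_i), in which a single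
    differing coordinate produces a zero factor. *)
Lemma chi_sum x y :
  \sum_S chi S x * chi S y = (x == y)%:R * #|{: cube}|%:R.
Proof.
have -> : \sum_S chi S x * chi S y = \prod_i ((-1) ^+ (x i (+) y i) + 1).
  rewrite bigA_distr; apply: eq_bigr => S _.
  rewrite /chi -big_split /= [LHS]big_mkcond /=; apply: eq_bigr => i _.
  by case: (i \in S); rewrite // signr_addb.
have [<-|/eqP xy] := eqVneq x y.
  under eq_bigr do rewrite addbb -(natrD _ 1 1).
  by rewrite prodr_const mul1r card_ffun card_bool natrX.
rewrite mul0r; apply/eqP/prodf_eq0.
have [i xyi] : exists i, x i != y i.
  apply/existsP; rewrite -negb_forall; apply: contra_notN xy => /forallP xy.
  by apply/ffunP => i; apply/eqP.
by exists i => //; case: (x i) (y i) xyi => -[] // _; rewrite addNr.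
Qed.

Lemma fourier_inversion f x : f x = \sum_S coef f S * chi S x.
Proof.
rewrite /coef /expect; under eq_bigr do rewrite -mulrA mulr_suml.
rewrite -mulr_sumr exchange_big /=.
under eq_bigr do under eq_bigr do rewrite -mulrA.
under eq_bigr do rewrite -mulr_sumr chi_sum.
rewrite (bigD1 x) //= eqxx mul1r big1 ?addr0 => [|y /negPf->]; last first.
  by rewrite mul0r mulr0.
by rewrite mulrCA mulVf ?mulr1 ?card_cube_neq0.
Qed.

Lemma parseval f g : expect (fun x => f x * g x) = \sum_S coef f S * coef g S.
Proof.
under eq_expect => x.
  rewrite [g x]fourier_inversion mulr_sumr.
  under eq_bigr do rewrite mulrCA.
  over.
by rewrite expect_sum; apply: eq_bigr => S _; rewrite expectZ mulrC.
Qed.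

Lemma coef_flip f i S :
  coef (fun x => f (flip i x)) S = (-1) ^+ (i \in S) * coef f S.
Proof.
rewrite /coef -(expect_reindex _ (inv_inj (flipK i))) -expectZ.
by apply: eq_expect => x; rewrite flipK chi_flip mulrCA.
Qed.

Lemma coef_diff f i S :
  coef (fun x => f x - f (flip i x)) S = (if i \in S then 2 else 0) * coef f S.
Proof.
have -> : coef (fun x => f x - f (flip i x)) S =
          coef f S + (-1) * coef (fun x => f (flip i x)) S.
  by rewrite /coef -expectZ -expectD; apply: eq_expect => x; ring.
by rewrite coef_flip; case: (i \in S); rewrite ?expr0 ?expr1; ring.
Qed.

Lemma influenceE f i : influence f i = 4 * \sum_(S : {set I} | i \in S) coef f S ^+ 2.
Proof.
rewrite /influence; under eq_expect do rewrite expr2.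
rewrite parseval mulr_sumr [RHS]big_mkcond; apply: eq_bigr => S _.
by rewrite coef_diff; case: (i \in S); ring.
Qed.

(** Flipping a bit in [S] changes the sign of the character but not its mean. *)
Lemma expect_chi S : expect (chi S) = (S == set0)%:R.
Proof.
have [->|/set0Pn[i iS]] := eqVneq S set0.
  rewrite (eq_expect (G := fun=> 1)) ?expect_cst ?card_cube_gt0 // => x.
  by rewrite /chi big_set0.
have := expect_reindex (chi S) (inv_inj (flipK i)).
under eq_expect do rewrite chi_flip iS.
rewrite expectZ expr1 mulN1r => /eqP.
by rewrite eq_sym -addr_eq0 -mulr2n mulrn_eq0 /= => /eqP.
Qed.

(** Averaging the coordinates outside [J] kills every character not supported in [J]. *)
Lemma expect_splice f J x :
  expect (fun y => f (splice J x y)) =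
  \sum_(S : {set I} | S \subset J) coef f S * chi S x.
Proof.
under eq_expect => y do rewrite fourier_inversion.
rewrite expect_sum [RHS]big_mkcond; apply: eq_bigr => S _; rewrite expectZ.
have chiE y : chi S (splice J x y) = chi (S :&: J) x * chi (S :\: J) y.
  rewrite /chi (big_setID J) /=; congr (_ * _); apply: eq_bigr => i.
    by rewrite inE ffunE => /andP[_ ->].
  by rewrite inE ffunE => /andP[/negPf-> _].
under eq_expect do rewrite chiE.
rewrite expectZ expect_chi setD_eq0; case: ifP => [/setIidPl->|_].
  by rewrite mulr1.
by rewrite !mulr0.
Qed.

(** The spliced point is itself uniform, so both squares have the full Fourier mass as mean; the
    cross term is -2 times the mass inside [J]. *)
Lemma splice_variance f J :
  expect (fun x => expect (fun y => (f x - f (splice J x y)) ^+ 2)) =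
  2 * \sum_(S : {set I} | ~~ (S \subset J)) coef f S ^+ 2.
Proof.
pose s (p : cube * cube) := (splice J p.1 p.2, splice J p.2 p.1).
have sK : involutive s.
  case=> x y; apply/eqP; rewrite /s xpair_eqE /=.
  by apply/andP; split; apply/eqP/ffunP => i; rewrite !ffunE; case: (i \in J).
under eq_expect => x.
  under eq_expect => y.
    have -> : (f x - f (splice J x y)) ^+ 2 =
      f x ^+ 2 + f (s (x, y)).1 ^+ 2 + (- 2 * f x) * f (splice J x y) by ring.
    over.
  rewrite !expectD expect_cst ?card_cube_gt0 // [X in _ + X]expectZ expect_splice.
  rewrite mulr_sumr.
  under [X in _ + X]eq_bigr => S _.
    have -> : - 2 * f x * (coef f S * chi S x) = -2 * coef f S * (f x * chi S x).
      by ring.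
    over.
  over.
rewrite !expectD (expect_swap (fun x => f x ^+ 2)) ?card_cube_gt0 // expect_sum.
have -> : expect (fun x => f x ^+ 2) = \sum_S coef f S ^+ 2.
  under eq_expect do rewrite expr2.
  by rewrite parseval; apply: eq_bigr => S _; rewrite expr2.
under [X in _ + X]eq_bigr do rewrite expectZ -/(coef _ _) -mulrA -expr2.
rewrite -mulr_sumr (bigID (fun S => S \subset J)) /=; ring.
Qed.

Lemma sum_subset_D1 (V : nmodType) A i (F : {set I} -> V) : i \in A ->
  \sum_(S : {set I} | S \subset A) F S =
  \sum_(S : {set I} | S \subset A :\ i) (F S + F (i |: S)).
Proof.
move=> iA; rewrite (bigID (fun S => i \in S)) /= addrC big_split /=; congr (_ + _).
  by apply: eq_bigl => S; rewrite subsetD1.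
rewrite (reindex_onto (fun S => i |: S) (fun S => S :\ i)) => [|S /andP[_ iS]].
  apply: eq_bigl => S; rewrite subUset sub1set iA setU11 andbT /= subsetD1.
  congr (_ && _); apply/eqP/idP => [<-|iS]; first by rewrite setD11.
  by rewrite setU1K.
exact: setD1K.
Qed.

(* Bonami's hypercontractive inequality from L^2 to L^4 for the noise operator of
   parameter 1 / sqrt 3, stated on the Fourier coefficients of the image so that
   no square root occurs. *)
Lemma bonami A (c : {set I} -> R) :
  expect (fun x => (\sum_(S : {set I} | S \subset A) c S * chi S x) ^+ 4) <=
  (\sum_(S : {set I} | S \subset A) 3 ^+ #|S| * c S ^+ 2) ^+ 2.
Proof.
have [m] := ubnP #|A|; elim: m => // m IHm in A c *; rewrite ltnS => leAm.
have [->|/set0Pn[i iA]] := eqVneq A set0.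
  under eq_bigl do rewrite subset0.
  under eq_expect => x.
    under eq_bigl do rewrite subset0.
    rewrite big_pred1_eq /chi big_set0 mulr1.
    over.
  by rewrite expect_cst ?card_cube_gt0 // big_pred1_eq cards0 mul1r -exprM.
have ltAm : (#|A :\ i| < m)%N.
  by rewrite (leq_trans _ leAm) // [in X in (_ < X)%N](cardsD1 i A) iA.
(* Induction on the size of [A]: with coordinate [i] split off, the polynomial is [u] + (-1)^(x_i)
   [v], where [u] and [v] do not depend on bit [i]. *)
pose c' S := c (i |: S).
pose u x := \sum_(S : {set I} | S \subset A :\ i) c S * chi S x.
pose v x := \sum_(S : {set I} | S \subset A :\ i) c' S * chi S x.
pose U := \sum_(S : {set I} | S \subset A :\ i) 3 ^+ #|S| * c S ^+ 2.
pose V := \sum_(S : {set I} | S \subset A :\ i) 3 ^+ #|S| * c' S ^+ 2.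
have U0 : 0 <= U.
  by apply: sumr_ge0 => S _; rewrite mulr_ge0 ?sqr_ge0 ?exprn_ge0.
have V0 : 0 <= V.
  by apply: sumr_ge0 => S _; rewrite mulr_ge0 ?sqr_ge0 ?exprn_ge0.
have uU : expect (fun x => u x ^+ 4) <= U ^+ 2 by exact: IHm.
have vV : expect (fun x => v x ^+ 4) <= V ^+ 2 by exact: IHm.
have uvE : expect (fun x => u x ^+ 2 * v x ^+ 2) <= U * V.
  have UV0 : 0 <= U * V by exact: mulr_ge0.
  rewrite -(@ler_pXn2r _ 2) ?nnegrE //; last first.
    by apply: expect_ge0 => x; rewrite mulr_ge0 ?sqr_ge0.
  apply: le_trans (cauchy_schwarz _ _) _; rewrite exprMn.
  under eq_expect do rewrite -exprM.
  under [X in _ * X]eq_expect do rewrite -exprM.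
  by apply: ler_pM => //; apply: expect_ge0 => x; rewrite exprn_even_ge0.
have flipD (w : {set I} -> R) x :
    \sum_(S : {set I} | S \subset A :\ i) w S * chi S (flip i x) =
    \sum_(S : {set I} | S \subset A :\ i) w S * chi S x.
  apply: eq_bigr => S; rewrite subsetD1 => /andP[_ /negPf iS].
  by rewrite chi_flip iS mul1r.
have sumE x : \sum_(S : {set I} | S \subset A) c S * chi S x =
    u x + (-1) ^+ x i * v x.
  rewrite (sum_subset_D1 _ iA) big_split mulr_sumr; congr (_ + _).
  apply: eq_bigr => S; rewrite subsetD1 => /andP[_ iS].
  by rewrite /chi big_setU1 // mulrCA.
have -> :
    expect (fun x => (\sum_(S : {set I} | S \subset A) c S * chi S x) ^+ 4) =
    expect (fun x => u x ^+ 4) + 6 * expect (fun x => u x ^+ 2 * v x ^+ 2)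
    + expect (fun x => v x ^+ 4).
  under eq_expect do rewrite sumE.
  (* A flip of bit [i] reverses the sign of [v] alone; averaging the two forms of [E] cancels the
     odd powers of [v]. *)
  set E := LHS.
  have E1 : E = expect (fun x => (u x - (-1) ^+ x i * v x) ^+ 4).
    rewrite /E -(expect_reindex _ (inv_inj (flipK i))); apply: eq_expect => x.
    by rewrite /u /v !flipD ffunE eqxx signr_addb mulrN1 mulNr.
  have E2 : E + E = 2 * (expect (fun x => u x ^+ 4)
      + 6 * expect (fun x => u x ^+ 2 * v x ^+ 2) + expect (fun x => v x ^+ 4)).
    rewrite [X in _ + X]E1 /E -expectD -expectZ -!expectD -expectZ.
    by apply: eq_expect => x; case: (x i); rewrite ?expr0 ?expr1; ring.
  lra.
have -> : \sum_(S : {set I} | S \subset A) 3 ^+ #|S| * c S ^+ 2 = U + 3 * V.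
  rewrite (sum_subset_D1 _ iA) big_split /= mulr_sumr; congr (_ + _).
  apply: eq_bigr => S; rewrite subsetD1 => /andP[_ iS].
  by rewrite cardsU1 iS add1n exprS -mulrA.
(* The three bounds give U^2 + 6 U V + V^2, which (U + 3 V)^2 exceeds by 8 V^2: the weight 3 is what
   the cross term needs. *)
nra.
Qed.

(* The derivative g of h satisfies g^3 = g, so E[g u] = E[g (g^2 u)] and
   E[g^4 u^2] = E[g^2 u^2]: two uses of Cauchy-Schwarz replace Hoelder's
   inequality with exponents 4/3 and 4. *)
Lemma level_inequality h i (sigma : R) :
    (forall x, (h x == 0) || (h x == 1)) -> 0 <= sigma ->
    influence h i <= sigma ^+ 2 ->
  4 * \sum_(S : {set I} | i \in S) (3 ^+ #|S|)^-1 * coef h S ^+ 2 <=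
  sigma * influence h i.
Proof.
move=> h01 sigma0 p_le; pose g x := h x - h (flip i x); pose p := influence h i.
have p0 : 0 <= p by apply: expect_ge0 => x; apply: sqr_ge0.
(* [u] is the noise operator of parameter 1/3 applied to [g], and [a] is its inner product with
   [g]. *)
pose c S := (3 ^+ #|S|)^-1 * coef g S; pose u x := \sum_S c S * chi S x.
pose a := \sum_S c S * coef g S.
have -> : 4 * \sum_(S : {set I} | i \in S) (3 ^+ #|S|)^-1 * coef h S ^+ 2 = a.
  rewrite mulr_sumr big_mkcond; apply: eq_bigr => S _.
  by rewrite /c /g coef_diff; case: (i \in S); ring.
have a0 : 0 <= a.
  apply: sumr_ge0 => S _; rewrite -mulrA -expr2.
  by rewrite mulr_ge0 ?sqr_ge0 ?invr_ge0 ?exprn_ge0.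
have u4 : expect (fun x => u x ^+ 4) <= a ^+ 2.
  have := bonami setT c.
  (* Bonami's weight 3^|S| cancels one of the two factors 3^-|S| in the square of [c S], which
     leaves exactly [a]. *)
  have -> : \sum_(S : {set I} | S \subset setT) 3 ^+ #|S| * c S ^+ 2 = a.
    apply: eq_big => [S|S _]; first exact: subsetT.
    have t0 : 3 ^+ #|S| != 0 :> R by rewrite expf_neq0 ?pnatr_eq0.
    by rewrite /c; field.
  by under eq_expect do under eq_bigl do rewrite subsetT.
have gu : expect (fun x => g x * u x) = a.
  under eq_expect do rewrite mulr_sumr.
  rewrite expect_sum; apply: eq_bigr => S _.
  under eq_expect do rewrite mulrCA.
  by rewrite expectZ.
have g3 x : g x ^+ 3 = g x.
  rewrite /g; case/orP: (h01 x) => /eqP->;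
    case/orP: (h01 (flip i x)) => /eqP->; ring.
have g4 x : (g x ^+ 2) ^+ 2 = g x ^+ 2.
  by rewrite -exprM (_ : 2 * 2 = 4)%N // exprS g3 -expr2.
have a2 : a ^+ 2 <= p * expect (fun x => g x ^+ 2 * u x ^+ 2).
  have := cauchy_schwarz g (fun x => g x ^+ 2 * u x).
  under eq_expect do rewrite mulrA -exprS g3.
  rewrite gu => /le_trans; apply; rewrite le_eqVlt; apply/orP; left; apply/eqP.
  by congr (_ * _); apply: eq_expect => x; rewrite exprMn g4.
have b0 : 0 <= expect (fun x => g x ^+ 2 * u x ^+ 2).
  by apply: expect_ge0 => x; rewrite mulr_ge0 ?sqr_ge0.
have b2 : expect (fun x => g x ^+ 2 * u x ^+ 2) ^+ 2 <= p * a ^+ 2.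
  apply: le_trans (cauchy_schwarz _ _) _.
  have -> : expect (fun x => (g x ^+ 2) ^+ 2) = p.
    by apply: eq_expect => x; exact: g4.
  by apply: ler_wpM2l => //; under eq_expect do rewrite -exprM.
set b := expect _ in a2 b0 b2.
(* Elimination of [b] between a^2 <= p b and b^2 <= p a^2. *)
have a4 : a ^+ 2 * a ^+ 2 <= p ^+ 3 * a ^+ 2.
  apply: (@le_trans _ _ ((p * b) ^+ 2)).
    by have pb0 := mulr_ge0 p0 b0; rewrite -expr2 ler_pXn2r ?nnegrE ?sqr_ge0.
  have -> : p ^+ 3 * a ^+ 2 = p ^+ 2 * (p * a ^+ 2) by ring.
  by rewrite exprMn ler_wpM2l ?sqr_ge0.
have [->|a_neq0] := eqVneq a 0; first by rewrite mulr_ge0.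
have {a4} a4 : a ^+ 2 <= p ^+ 3.
  by move: a4; rewrite ler_pM2r // lt_def sqr_ge0 sqrf_eq0 a_neq0.
have sp0 : 0 <= sigma * p by exact: mulr_ge0.
(* In a^2 <= p^3, one of the three factors p is at most sigma^2. *)
rewrite -/p -(@ler_pXn2r _ 2) ?nnegrE //; apply: le_trans a4 _.
by rewrite exprS [leRHS]exprMn ler_wpM2r ?sqr_ge0.
Qed.

(** A set with at least [d] elements is counted at least [d] times in the total influence. A smaller
    set not inside [J] contains some [i] outside [J], and is charged to the level inequality at [i]
    at the price 3^d. *)
Lemma variance_off_influential h J (d : nat) (sigma : R) :
    (forall x, (h x == 0) || (h x == 1)) -> 0 <= sigma -> (0 < d)%N ->
    (forall i, i \notin J -> influence h i <= sigma ^+ 2) ->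
  4 * \sum_(S : {set I} | ~~ (S \subset J)) coef h S ^+ 2 <=
  (d%:R^-1 + 3 ^+ d * sigma) * \sum_i influence h i.
Proof.
move=> h01 sigma0 d0 infJ.
have d0R : 0 < d%:R :> R by rewrite ltr0n.
(* [w] adds up both charges, so that it is at least 1 on every set not inside [J]. *)
pose w (S : {set I}) : R := \sum_i (i \in S)%:R *
  (d%:R^-1 + (i \notin J)%:R * 3 ^+ d * (3 ^+ #|S|)^-1).
have w0 S : 0 <= w S.
  apply: sumr_ge0 => i _; rewrite mulr_ge0 // addr_ge0 ?invr_ge0 //.
  by rewrite !mulr_ge0 ?invr_ge0 ?exprn_ge0.
have w1 S : ~~ (S \subset J) -> 1 <= w S.
  case/subsetPn => i iS iJ; have [dS|Sd] := leqP d #|S|.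
    apply: (@le_trans _ _ (\sum_i (i \in S)%:R * d%:R^-1)).
      rewrite -mulr_suml -natr_sum -big_mkcond /= sum1_card.
      by rewrite ler_pdivlMr // mul1r ler_nat.
    apply: ler_sum => j _; rewrite ler_wpM2l // lerDl.
    by rewrite !mulr_ge0 ?invr_ge0 ?exprn_ge0.
  rewrite /w (bigD1 i) //= iS iJ !mul1r -[leLHS]addr0 lerD //.
    rewrite -[leLHS]add0r lerD ?invr_ge0 ?(ltW d0R) //.
    by rewrite ler_pdivlMr ?exprn_gt0 // mul1r ler_eXn2l ?ltr1n // ltnW.
  apply: sumr_ge0 => j _; rewrite mulr_ge0 // addr_ge0 ?invr_ge0 //.
  by rewrite !mulr_ge0 ?invr_ge0 ?exprn_ge0.
apply: (@le_trans _ _ (4 * \sum_S w S * coef h S ^+ 2)).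
  rewrite ler_wpM2l // [leRHS](bigID (fun S : {set I} => ~~ (S \subset J))) /=.
  rewrite -[leLHS]addr0 lerD //.
    by apply: ler_sum => S /w1 ?; rewrite ler_peMl ?sqr_ge0.
  by apply: sumr_ge0 => S _; rewrite mulr_ge0 ?sqr_ge0.
under eq_bigr do rewrite mulr_suml.
rewrite exchange_big /= !mulr_sumr; apply: ler_sum => i _.
have -> : 4 * (\sum_(S : {set I}) (i \in S)%:R *
    (d%:R^-1 + (i \notin J)%:R * 3 ^+ d * (3 ^+ #|S|)^-1) * coef h S ^+ 2) =
  d%:R^-1 * influence h i + (i \notin J)%:R * 3 ^+ d *
    (4 * \sum_(S : {set I} | i \in S) (3 ^+ #|S|)^-1 * coef h S ^+ 2).
  rewrite influenceE [X in _ * (4 * X) + _]big_mkcond.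
  rewrite [X in _ + _ * (4 * X)]big_mkcond /= !mulr_sumr -big_split.
  by apply: eq_bigr => S _; case: (i \in S); rewrite /= ?mulr0n ?mulr1n; ring.
rewrite [leRHS]mulrDl lerD2l; have [iJ|iJ] := boolP (i \in J).
  rewrite !mul0r; apply: mulr_ge0; first by rewrite mulr_ge0 ?exprn_ge0.
  by apply: expect_ge0 => x; apply: sqr_ge0.
by rewrite mul1r -mulrA ler_wpM2l ?exprn_ge0 // level_inequality ?infJ.
Qed.

End Cube.

(** * Half-circles and the cyclic distance *)

Lemma sum_interval n a b :
  (\sum_(u < n) (a <= u < b)%N = minn b n - a)%N.
Proof.
elim: n => [|n IHn]; first by rewrite big_ord0; lia.
by rewrite big_ord_recr IHn /=; case: (leqP a n); case: (ltnP n b); lia.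
Qed.

(** Coordinate [r] of the embedding of Z_l into {0,1}^l, given by the arc of [l./2] residues that
    starts at [r]. *)
Definition half_arc l (r s : 'Z_l) : bool := ((s - r)%R < l./2)%N.

Lemma cyc_absN l (s : 'Z_l) : (2 <= l)%N -> cyc_abs (- s) = cyc_abs s.
Proof.
case: l s => [|[|l]] // s _; rewrite /cyc_abs /=.
change (Zp_trunc l.+2) with l in *.
have /= := ltn_ord s; move: (nat_of_ord s) => a lta.
have [->|a0] := posnP a; first by rewrite subn0 modnn; lia.
by rewrite modn_small; lia.
Qed.

(** Let d = t - s be at most l/2. An arc contains [s] but not [t] when [s] is among its last d
    points, and [t] but not [s] when [s] is among the d residues just before its start: d arcs of
    each kind. *)
Lemma sum_half_arc l (s t : 'Z_l) : (2 <= l)%N ->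
  (\sum_(r : 'Z_l) (half_arc r s != half_arc r t) = (cyc_abs (s - t)%R).*2)%N.
Proof.
move=> l2; wlog : s t / ((t - s)%R <= l./2)%N => [wl|].
  have [/wl//|lt_ts] := leqP (t - s)%R l./2.
  rewrite -opprB cyc_absN // -wl.
    by apply: eq_bigr => r _; rewrite eq_sym.
  rewrite -opprB; move: (t - s) lt_ts => {wl s t} d.
  case: l l2 d => [|[|l]] // _ d /= ltd; have /= := ltn_ord d => ltdl.
  change (Zp_trunc l.+2) with l in *.
  rewrite modn_small; lia.
have [d tE] : exists d, t = d + s by exists (t - s); rewrite subrK.
rewrite -(opprB t s) cyc_absN // {t}tE addrK => led.
rewrite (reindex_inj (inv_inj (subKr s))) /half_arc.
under eq_bigr => u _ do rewrite subKr -addrA subKr addrC.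
case: l l2 s d led => [|[|l]] // _ s d /= led; rewrite /cyc_abs /=.
change (Zp_trunc l.+2) with l in *.
have /= := ltn_ord d; move: (nat_of_ord d) led => {}d led ltd.
rewrite (_ : minn d _ = d); last by lia.
transitivity (\sum_(u < l.+2) ((uphalf l.+1 - d <= u < uphalf l.+1) +
   (l.+2 - d <= u < l.+2)))%N; last first.
  by rewrite big_split /= !sum_interval; lia.
apply: eq_bigr => u _ /=; have /= := ltn_ord u; move: (nat_of_ord u) => {}u ltu.
have [lt_ud|le_ud] := ltnP (u + d) l.+2.
  by rewrite modn_small //; lia.
rewrite -[X in (X %% _)%N](subnK le_ud) modnDr modn_small; last by lia.
lia.
Qed.

Section CyclicDistance.
Variables (R : realFieldType) (l : nat).
Hypothesis l2 : (2 <= l)%N.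
Implicit Types s t u : 'Z_l.

Definition cdist s t : R := (cyc_abs (s - t))%:R.

Lemma sum_half_arc_sqr s t :
  \sum_(r : 'Z_l) ((half_arc r s)%:R - (half_arc r t)%:R) ^+ 2 = 2 * cdist s t.
Proof.
rewrite /cdist -natrM mul2n -sum_half_arc // natr_sum; apply: eq_bigr => r _.
by case: (half_arc r s); case: (half_arc r t);
  rewrite /= ?subrr ?subr0 ?sub0r ?sqrrN ?expr0n ?expr1n.
Qed.

Lemma cdist_ge0 s t : 0 <= cdist s t. Proof. exact: ler0n. Qed.

Lemma cdistss s : cdist s s = 0.
Proof. by rewrite /cdist subrr /cyc_abs /= min0n. Qed.

Lemma cdistC s t : cdist s t = cdist t s.
Proof. by rewrite /cdist -opprB cyc_absN. Qed.

(** Twice the distance is a Hamming distance, so the inequality can be checked coordinate by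
    coordinate. *)
Lemma cdist_triangle s t u : cdist s u <= cdist s t + cdist t u.
Proof.
rewrite -(@ler_pM2l _ 2) // mulrDr -!sum_half_arc_sqr -big_split.
apply: ler_sum => r _ /=.
by case: (half_arc r s); case: (half_arc r t); case: (half_arc r u);
  rewrite ?mulr0n ?mulr1n; lra.
Qed.

(** The triangle inequality along [h]. Indicators over a fixed range of [t] allow a later average
    over the endpoints to act on them alone; there are two because either endpoint may be the
    larger. *)
Lemma cdist_path (h : nat -> 'Z_l) K a b : (a <= K)%N -> (b <= K)%N ->
  cdist (h a) (h b) <= \sum_(t < K)
    ((a <= t < b)%N + (b <= t < a)%N)%:R * cdist (h t) (h t.+1).
Proof.
wlog le_ab : a b / (a <= b)%N => [wl|] aK bK.
  have [/wl|/ltnW/wl] := leqP a b; first exact.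
  by rewrite cdistC => /(_ bK aK); under eq_bigr do rewrite addnC.
apply: (@le_trans _ _ (\sum_(t < K) (a <= t < b)%N%:R * cdist (h t) (h t.+1))).
  elim: b bK le_ab => [|b IHb] bK.
    rewrite leqn0 => /eqP->; rewrite cdistss; apply: sumr_ge0 => t _.
    by rewrite mulr_ge0 ?cdist_ge0.
  rewrite leq_eqVlt => /predU1P[->|le_ab].
    rewrite cdistss; apply: sumr_ge0 => t _.
    by rewrite mulr_ge0 ?cdist_ge0.
  apply: le_trans (cdist_triangle _ (h b) _) _.
  apply: (@le_trans _ _ (\sum_(t < K) ((a <= t < b)%N%:R * cdist (h t) (h t.+1)
      + (t == b :> nat)%:R * cdist (h t) (h t.+1)))).
    rewrite big_split lerD ?IHb ?(ltnW bK) //=.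
    rewrite (bigD1 (Ordinal bK)) //= eqxx mul1r lerDl.
    by apply: sumr_ge0 => t _; rewrite mulr_ge0 ?cdist_ge0.
  apply: ler_sum => t _; rewrite -mulrDl -natrD ler_wpM2r ?cdist_ge0 // ler_nat.
  lia.
by apply: ler_sum => t _; rewrite ler_wpM2r ?cdist_ge0 // ler_nat leq_addr.
Qed.

End CyclicDistance.

(** * Integers written in binary *)

Section Binary.
Variable N : nat.
Implicit Types (x y : {ffun 'I_N -> bool}) (b : 'I_N).

Definition binval y : nat := (\sum_b y b * 2 ^ b)%N.

Lemma binval_flip b y : (binval (flip b y) <= binval y + 2 ^ b)%N.
Proof.
rewrite /binval (bigD1 b) //= [in leqRHS](bigD1 b) //= ffunE eqxx.
rewrite (eq_bigr (fun j : 'I_N => (y j * 2 ^ j)%N)) => [|j /negPf jb]; last first.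
  by rewrite ffunE jb addbF.
by case: (y b) => /=; lia.
Qed.

End Binary.

Lemma binval_bound N (y : {ffun 'I_N -> bool}) : (binval y < 2 ^ N)%N.
Proof.
rewrite /binval; elim: N y => [|N IHN] y; first by rewrite big_ord0.
rewrite big_ord_recr /= expnS.
have := IHN [ffun b => y (widen_ord (leqnSn N) b)].
under eq_bigr do rewrite ffunE /=.
by case: (y ord_max) => /=; lia.
Qed.

(** The low bit is the parity of the value; the other bits follow by induction. *)
Lemma binval_inj N : injective (@binval N).
Proof.
rewrite /binval; elim: N => [|N IHN] x y; first by move=> _; apply/ffunP => -[].
pose tl (z : {ffun 'I_N.+1 -> bool}) := [ffun b => z (lift ord0 b)].
have recE (z : {ffun 'I_N.+1 -> bool}) :
    (\sum_b z b * 2 ^ b = z ord0 + (\sum_b tl z b * 2 ^ b).*2)%N.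
  rewrite big_ord_recl muln1 -mul2n big_distrr; congr (_ + _)%N.
  by apply: eq_bigr => b _; rewrite ffunE expnS mulnCA.
rewrite !recE => eq_xy.
have eq0 : x ord0 = y ord0.
  by have := congr1 odd eq_xy; rewrite !oddD !odd_double !addbF !oddb.
have /IHN/ffunP eqt : (\sum_b tl x b * 2 ^ b = \sum_b tl y b * 2 ^ b)%N.
  by move: eq_xy; rewrite eq0; lia.
apply/ffunP => b; case: (unliftP ord0 b) => [j|] -> //.
by have := eqt j; rewrite !ffunE.
Qed.

Lemma sum_binval N (P : nat -> nat) :
  (\sum_(y : {ffun 'I_N -> bool}) P (binval y) = \sum_(v < 2 ^ N) P v)%N.
Proof.
pose f (y : {ffun 'I_N -> bool}) : 'I_(2 ^ N) := Ordinal (binval_bound y).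
rewrite [RHS](reindex f) //=; apply: onW_bij; apply: inj_card_bij.
  by move=> x y /(congr1 val)/binval_inj.
by rewrite card_ord card_ffun card_bool card_ord.
Qed.

(** * Cells of the encoding and their boundaries *)

Section Cells.
Variables (k N : nat).
Hypothesis k0 : (0 < k)%N.
Notation word := {ffun 'I_N -> bool}.

Definition cell (y : word) : nat := (binval y * k %/ 2 ^ N)%N.

Lemma cell_lt y : (cell y < k)%N.
Proof. by rewrite /cell ltn_divLR ?expn_gt0 // mulnC ltn_pmul2l // binval_bound. Qed.

Lemma cell_size t : (t < k)%N ->
  (2 ^ N <= k * \sum_(y : word) (cell y == t) + k)%N /\
  (k * \sum_(y : word) (cell y == t) <= 2 ^ N + k)%N.
Proof.
(* [c t] is t 2^N / k rounded up. Cell [t] is the interval from [c t] to [c t.+1], the latter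
   excluded, so its size is within 1 of 2^N / k. *)
move=> ltk; pose c t := ((t * 2 ^ N + k.-1) %/ k)%N.
have Q0 : (0 < 2 ^ N)%N by rewrite expn_gt0.
have cP v u : (c u <= v)%N = (u * 2 ^ N <= v * k)%N.
  rewrite /c -ltnS ltn_divLR //; lia.
have -> : (\sum_(y : word) (cell y == t) = \sum_(v < 2 ^ N) (c t <= v < c t.+1))%N.
  rewrite -(sum_binval N (fun v => (c t <= v < c t.+1)%N : nat)).
  apply: eq_bigr => y _; congr (nat_of_bool _).
  rewrite ltnNge !cP -ltnNge /cell eqn_leq andbC -leq_divRL //; congr (_ && _).
  by rewrite -ltnS ltn_divLR.
rewrite sum_interval.
have cle : (c t.+1 <= 2 ^ N)%N by rewrite cP mulnC leq_pmul2l.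
rewrite (minn_idPl cle).
have c_ge u : (u * 2 ^ N <= c u * k)%N by rewrite -cP.
have c_le u : (c u * k <= u * 2 ^ N + k.-1)%N by rewrite /c leq_trunc_div.
move: (c_ge t) (c_le t) (c_ge t.+1) (c_le t.+1); rewrite mulSn mulnC !(mulnC (c _)).
by rewrite mulnBr; lia.
Qed.

(** Indicator that flipping bit [b] crosses the boundary between the cells [t] and [t.+1], in either
    direction. *)
Definition straddle t b (y : word) : nat :=
  ((cell y <= t < cell (flip b y))%N + (cell (flip b y) <= t < cell y)%N)%N.

(** A flip raises the value v by at most 2^b, so an upward crossing of the boundary [q] forces v < q
    <= v + 2^b, which leaves at most 2^b values. Downward crossings are the images of upward ones
    under the flip. *)
Lemma sum_straddle t b : (\sum_y straddle t b y <= 2 * 2 ^ b)%N.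
Proof.
have Q0 : (0 < 2 ^ N)%N by rewrite expn_gt0.
have half : (\sum_y (cell y <= t < cell (flip b y))%N <= 2 ^ b)%N.
  pose q := ((t.+1 * 2 ^ N + k.-1) %/ k)%N.
  have qP v : (q <= v)%N = (t.+1 * 2 ^ N <= v * k)%N.
    rewrite /q -ltnS ltn_divLR //; lia.
  apply: (@leq_trans (\sum_y (q - 2 ^ b <= binval y < q)%N)).
    apply: leq_sum => y _; case: (leqP (cell y) t) => //= le_yt.
    case: (leqP (cell (flip b y)) t) => //= lt_ty.
    have -> : (binval y < q)%N by rewrite ltnNge qP -ltnNge -ltn_divLR // ltnS.
    have -> // : (q - 2 ^ b <= binval y)%N.
    rewrite leq_subLR addnC qP.
    apply: leq_trans (leq_mul (binval_flip b y) (leqnn k)).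
    by rewrite -leq_divRL.
  rewrite (sum_binval N (fun v => (q - 2 ^ b <= v < q)%N : nat)) sum_interval; lia.
rewrite /straddle big_split /= mul2n -addnn leq_add //.
rewrite (reindex_inj (inv_inj (flipK b))) /=.
by under eq_bigr do rewrite flipK.
Qed.

End Cells.

(** * Powers of numbers close to 1 *)

Section Distortion.
Variable R : realFieldType.

Lemma bernoulli_le (eta : R) n : 0 <= eta <= 1 -> 1 - n%:R * eta <= (1 - eta) ^+ n.
Proof.
case/andP=> eta0 eta1; elim: n => [|n IHn]; first by rewrite mul0r subr0.
have n0 : 0 <= n%:R :> R by [].
rewrite exprS -natr1; have : (1 - eta) * (1 - n%:R * eta) <= (1 - eta) * (1 - eta) ^+ n.
  by rewrite ler_wpM2l // subr_ge0.
by apply: le_trans; nra.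
Qed.

(** (1 + eta)^n is at most the inverse of (1 - eta)^n, to which Bernoulli's inequality applies. *)
Lemma expr_1D_le2 (eta : R) n : 0 <= eta <= 1 -> n%:R * eta <= 2^-1 ->
  (1 + eta) ^+ n <= 2.
Proof.
move=> eta01 n_eta; have := bernoulli_le n eta01 => b_le.
have h : 2^-1 <= (1 - eta) ^+ n by lra.
have : (1 + eta) ^+ n * (1 - eta) ^+ n <= 1.
  rewrite -exprMn exprn_ile1 //; case/andP: eta01 => ? ?; nra.
have : 0 <= (1 + eta) ^+ n by rewrite exprn_ge0 //; case/andP: eta01 => ? ?; lra.
nra.
Qed.

End Distortion.

(** * Transfer between the grid Z_k^n and the cube *)

Section Encoding.
Variables (R : realType) (k n N : nat).
Hypotheses (k2 : (2 <= k)%N) (n0 : (0 < n)%N) (N_large : (2 * n * k <= 2 ^ N)%N).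
Notation word := {ffun 'I_N -> bool}.
Notation cube := {ffun 'I_n * 'I_N -> bool}.
Notation grid := 'rV['Z_k]_n.
Implicit Types (x y : cube) (z : grid) (i : 'I_n) (b : 'I_N) (G : grid -> R).

Let k0 : (0 < k)%N. Proof. exact: ltnW. Qed.

Definition block i x : word := [ffun b => x (i, b)].

Definition encode x : grid := \row_i (cell k (block i x))%:R.

Definition set_block i x (w : word) : cube :=
  [ffun j => if j.1 == i then w j.2 else x j].

Definition set_coord i z (t : 'Z_k) : grid :=
  \row_j if j == i then t else z 0 j.

Lemma card_Zk : #|'Z_k| = k.
Proof. by rewrite card_ord Zp_cast. Qed.

Lemma mean_expect G : mean G = expect G.
Proof. by rewrite /mean /expect card_mx card_Zk mul1n natrX. Qed.

Lemma natr_Zk_eq (a b : nat) : (a < k)%N -> (b < k)%N ->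
  ((a%:R : 'Z_k) == b%:R) = (a == b).
Proof. by move=> ak bk; rewrite -val_eqE /= !val_Zp_nat // !modn_small. Qed.

Lemma sum_Zk (F : 'Z_k -> R) : \sum_(t < k) F t%:R = \sum_(t : 'Z_k) F t.
Proof. by case: k k2 F => [|[|k']] // _ F; apply: eq_bigr => t _; rewrite natr_Zp. Qed.

(** The encoding acts on each block separately, so its fibres are products over the blocks. *)
Lemma encode_fiber z : \sum_x (encode x == z)%:R =
  \prod_i \sum_(w : word) ((cell k w)%:R == z 0 i)%:R :> R.
Proof.
pose uncurry (p : {ffun 'I_n -> word}) : cube := [ffun j => p j.1 j.2].
have blockE i p : block i (uncurry p) = p i.
  by apply/ffunP => b; rewrite !ffunE.
rewrite bigA_distr_bigA (reindex uncurry) /=; last first.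
  exists (fun x => [ffun i => block i x]) => [p _|x _].
    by apply/ffunP => i; rewrite ffunE blockE.
  by apply/ffunP => -[i b]; rewrite !ffunE.
apply: eq_bigr => p _; rewrite -natr_prod; congr _%:R.
have [<-|ne] := eqVneq.
  by rewrite big1 // => i _; rewrite mxE blockE eqxx.
have [i /eqP zi] : exists i, (cell k (p i))%:R != z 0 i.
  apply/existsP; rewrite -negb_forall; apply: contraNN ne => /forallP eqz.
  by apply/eqP/rowP => i; rewrite mxE blockE; apply/eqP.
by rewrite (bigD1 i) //=; case: eqP.
Qed.

(* The density, relative to the uniform measure, of the law of [encode x]. *)
Definition fiber_weight z : R :=
  k%:R ^+ n * (#|{: cube}|%:R^-1 * \sum_x (encode x == z)%:R).

Lemma expect_encode G :
  expect (fun x => G (encode x)) = expect (fun z => fiber_weight z * G z).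
Proof.
rewrite -mean_expect /mean /expect.
under [in RHS]eq_bigr do rewrite -!mulrA.
have kn0 : k%:R ^+ n != 0 :> R by rewrite expf_neq0 // pnatr_eq0 -lt0n.
rewrite -mulr_sumr mulKf // -mulr_sumr; congr (_ * _).
under [RHS]eq_bigr do rewrite mulr_suml.
rewrite exchange_big /=; apply: eq_bigr => x _.
rewrite (bigD1 (encode x)) //= eqxx mul1r big1 ?addr0 // => z.
by rewrite eq_sym => /negPf->; rewrite mul0r.
Qed.

Let Q0 : 0 < (2 ^ N)%:R :> R. Proof. by rewrite ltr0n expn_gt0. Qed.

Let eta : R := k%:R / (2 ^ N)%:R.

Let eta01 : 0 <= eta <= 1.
Proof.
rewrite divr_ge0 //= ler_pdivrMr // mul1r ler_nat (leq_trans _ N_large) //.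
by rewrite leq_pmull // muln_gt0.
Qed.

Let n_eta : n%:R * eta <= 2^-1.
Proof.
rewrite mulrA ler_pdivrMr // -(@ler_pM2l _ 2) // mulVKf ?pnatr_eq0 //.
by rewrite -!natrM mulnA ler_nat.
Qed.

(** The density is a product of [n] factors, each within [eta] = k / 2^N of 1 by the size of the
    cells; [N_large] says that n eta <= 1/2. *)
Lemma fiber_weight_bounds z : 2^-1 <= fiber_weight z <= 2.
Proof.
pose c i : R := (\sum_(w : word) (cell k w == z 0%R i))%N%:R.
have -> : fiber_weight z = \prod_(i < n) (k%:R * ((2 ^ N)%:R^-1 * c i)).
  rewrite /fiber_weight encode_fiber card_ffun card_bool card_prod !card_ord.
  rewrite !big_split /= !prodr_const card_ord; congr (_ * (_ * _)).
    by rewrite exprVn -natrX -expnM mulnC.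
  apply: eq_bigr => i _; rewrite /c natr_sum; apply: eq_bigr => w _; congr _%:R.
  rewrite -[z 0 i]natr_Zp natr_Zk_eq ?cell_lt ?natr_Zp //.
  by rewrite -[X in (_ < X)%N](Zp_cast k2) ltn_ord.
have c_bounds i : 1 - eta <= k%:R * ((2 ^ N)%:R^-1 * c i) <= 1 + eta.
  have zk : (z 0%R i < k)%N by rewrite -[X in (_ < X)%N](Zp_cast k2) ltn_ord.
  have [] := cell_size N k0 zk.
  rewrite -!(ler_nat R) !natrD !natrM -/(c i) => lo hi.
  rewrite mulrCA mulrC; apply/andP; split.
    rewrite ler_pdivlMr // mulrBl mul1r /eta mulfVK ?(lt0r_neq0 Q0) //; lra.
  by rewrite ler_pdivrMr // mulrDl mul1r /eta mulfVK ?(lt0r_neq0 Q0) //; lra.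
have [eta0 eta1] := andP eta01.
apply/andP; split.
  apply: (@le_trans _ _ (\prod_(i < n) (1 - eta))).
    rewrite prodr_const card_ord; apply: le_trans (bernoulli_le n eta01).
    by have := n_eta; lra.
  apply: ler_prod => i _; have /andP[-> _] := c_bounds i.
  by rewrite subr_ge0 eta1.
apply: (@le_trans _ _ (\prod_(i < n) (1 + eta))); last first.
  by rewrite prodr_const card_ord expr_1D_le2.
apply: ler_prod => i _; have /andP[lo ->] := c_bounds i.
by rewrite (le_trans _ lo) // subr_ge0.
Qed.

Lemma expect_encode_le G : (forall z, 0 <= G z) ->
  expect (fun x => G (encode x)) <= 2 * expect G.
Proof.
move=> G0; rewrite expect_encode -expectZ; apply: ler_expect => z.
by have /andP[_ w2] := fiber_weight_bounds z; rewrite ler_wpM2r.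
Qed.

Lemma expect_le_encode G : (forall z, 0 <= G z) ->
  expect G <= 2 * expect (fun x => G (encode x)).
Proof.
move=> G0; rewrite expect_encode -expectZ; apply: ler_expect => z.
have /andP[w2 _] := fiber_weight_bounds z.
by have := G0 z; nra.
Qed.

Lemma expect_set_block i (K : cube -> R) :
  expect (fun x => expect (fun w => K (set_block i x w))) = expect K.
Proof.
pose s (p : cube * word) := (set_block i p.1 p.2, block i p.1).
apply: (expect_swap (s := s) K); last by rewrite card_ffun card_bool expn_gt0.
case=> x w; apply/eqP; rewrite xpair_eqE /=; apply/andP; split; apply/eqP/ffunP.
  by move=> [j b]; rewrite !ffunE /=; case: eqP => [->|].
by move=> b; rewrite !ffunE /= eqxx.
Qed.

Lemma expect_set_coord i G :
  expect (fun z => \sum_(t < k) G (set_coord i z t%:R)) = k%:R * expect G.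
Proof.
under eq_expect => z do rewrite (sum_Zk (fun t => G (set_coord i z t))).
pose s (p : grid * 'Z_k) := (set_coord i p.1 p.2, p.1 0 i).
rewrite -(@expect_swap _ _ _ s G) ?card_Zk //; last first.
  case=> z t; apply/eqP; rewrite xpair_eqE /=; apply/andP; split; apply/eqP.
    by apply/rowP => j; rewrite !mxE; case: eqP => [->|].
  by rewrite mxE eqxx.
rewrite -expectZ; apply: eq_expect => z.
by rewrite /expect card_Zk mulrA divff ?mul1r // pnatr_eq0 -lt0n.
Qed.

Variables (l : nat) (f : grid -> 'Z_l).
Hypothesis l2 : (2 <= l)%N.
Let H i z : R := cdist R (f z) (f (z + delta_mx 0 i)).

(** Only coordinate [i] of the encoded point changes. Walking through its intermediate values one
    unit at a time costs one unit step of [f] per boundary crossed. *)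
Lemma encode_flip_le i b x :
  cdist R (f (encode x)) (f (encode (flip (i, b) x))) <=
  \sum_(t < k) (straddle k t b (block i x))%:R * H i (set_coord i (encode x) t%:R).
Proof.
pose h (t : nat) := f (set_coord i (encode x) t%:R).
have -> : f (encode x) = h (cell k (block i x)).
  by congr f; apply/rowP => j; rewrite !mxE; case: eqP => [->|].
have -> : f (encode (flip (i, b) x)) = h (cell k (flip b (block i x))).
  congr f; apply/rowP => j; rewrite !mxE; case: eqP => [->|/eqP/negPf ji].
    by congr (cell k _)%:R; apply/ffunP => a; rewrite !ffunE xpair_eqE eqxx.
  by congr (cell k _)%:R; apply/ffunP => a; rewrite !ffunE xpair_eqE ji addbF.
apply: le_trans (cdist_path R l2 h (ltnW (cell_lt k0 _)) (ltnW (cell_lt k0 _))) _.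
apply: ler_sum => t _; rewrite /H /h; apply: ler_wpM2l => //.
rewrite le_eqVlt; apply/orP; left; apply/eqP; congr (cdist R _ (f _)).
apply/rowP => j; rewrite !mxE eqxx /=; case: eqP => _; last by rewrite addr0.
by rewrite -natr1.
Qed.

(** Resample block [i]: the indicators depend only on this block and the unit steps only on the
    others, so the mean factors. A boundary is crossed with probability at most 2 2^b / 2^N, the
    passage to the uniform law on the grid costs another 2, and the sum over [t] gives k. *)
Lemma expect_encode_flip_le i b :
  expect (fun x => cdist R (f (encode x)) (f (encode (flip (i, b) x)))) <=
  4 * k%:R * (2 ^ b)%:R / (2 ^ N)%:R * expect (H i).
Proof.
have H0 z : 0 <= H i z by exact: cdist_ge0.
apply: le_trans (ler_expect (encode_flip_le i b)) _.
rewrite -(expect_set_block i).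
apply: (@le_trans _ _ (expect (fun x => \sum_(t < k)
    (2 * (2 ^ b)%:R / (2 ^ N)%:R) * H i (set_coord i (encode x) t%:R)))).
  apply: ler_expect => x.
  rewrite expect_sum; apply: ler_sum => t _.
  have eqH w : (straddle k t b (block i (set_block i x w)))%:R *
      H i (set_coord i (encode (set_block i x w)) t%:R) =
    H i (set_coord i (encode x) t%:R) * (straddle k t b w)%:R.
    rewrite mulrC; congr (H i _ * (straddle k t b _)%:R).
      apply/rowP => j; rewrite !mxE; case: eqP => // /eqP/negPf ji.
      by congr (cell k _)%:R; apply/ffunP => a; rewrite !ffunE /= ji.
    by apply/ffunP => a; rewrite !ffunE /= eqxx.
  under eq_expect do rewrite eqH.
  rewrite expectZ mulrC ler_wpM2r //.
  rewrite /expect card_ffun card_bool card_ord mulrC ler_wpM2r ?invr_ge0 //.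
  by rewrite -natr_sum -natrM ler_nat sum_straddle.
under eq_expect do rewrite -mulr_sumr.
rewrite expectZ.
have := expect_encode_le (G := fun z => \sum_(t < k) H i (set_coord i z t%:R)).
rewrite expect_set_coord => /(_ (fun z => sumr_ge0 _ (fun t _ => H0 _))) le1.
apply: (@le_trans _ _ (2 * (2 ^ b)%:R / (2 ^ N)%:R * (2 * (k%:R * expect (H i))))).
  by rewrite ler_wpM2l // divr_ge0 // mulr_ge0.
by rewrite le_eqVlt; apply/orP; left; apply/eqP; ring.
Qed.

(** The powers 2^b add up to less than 2^N, so the number of bits does not enter the bound. *)
Lemma total_cube_influence_le :
  \sum_(j : 'I_n * 'I_N)
     expect (fun x => cdist R (f (encode x)) (f (encode (flip j x)))) <=
  4 * k%:R * \sum_(i < n) expect (H i).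
Proof.
rewrite mulr_sumr -(pair_bigA _ (fun i b =>
  expect (fun x => cdist R (f (encode x)) (f (encode (flip (i, b) x)))))) /=.
apply: ler_sum => i _.
apply: le_trans (ler_sum _ (fun b _ => expect_encode_flip_le i b)) _.
have H0 : 0 <= expect (H i) by apply: expect_ge0 => z; exact: cdist_ge0.
rewrite -mulr_suml ler_wpM2r // -mulr_suml -mulr_sumr ler_pdivrMr //.
rewrite ler_wpM2l ?mulr_ge0 // -natr_sum ler_nat.
by have := predn_exp 2 N; rewrite mul1n => <-; exact: leq_pred.
Qed.

End Encoding.

(** * Numerical constants *)

(** [c] stands for the size of the junta and s^2 for the influence threshold. The constant is 248 =
    72 + 144 + 32: 72 a comes from 8 a and one factor 9, 144 a from 9^(d-1) with d - 1 <= 16 a and 9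
    <= e^9, and 32 a from d^2 <= (1 + 16 a)^2. The remaining [eps] is at most l. *)
Lemma friedgut_constants (R : realType) (a eps : R) (l d : nat) (c s : R) :
    0 <= a -> 0 <= eps <= l%:R -> d = (Num.truncn (16 * a)).+1 ->
    s = (3 ^+ d * d%:R)^-1 -> c * s ^+ 2 <= 8 * (a * eps) ->
  c <= l%:R * expR (248 * a).
Proof.
move=> a0 /andP[eps0 eps_l] -> -> cs; set m := Num.truncn _ in cs.
have m_le : m%:R <= 16 * a by rewrite -truncn_ge_nat ?mulr_ge0.
have {cs} : c <= 8 * (a * eps) * (9 * 9 ^+ m * m.+1%:R ^+ 2).
  have t0 : 0 < 9 * 9 ^+ m * m.+1%:R ^+ 2 :> R.
    by rewrite !mulr_gt0 ?exprn_gt0.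
  rewrite -ler_pdivrMr //; apply: le_trans cs.
  have -> : 9 * 9 ^+ m = (3 ^+ m.+1) ^+ 2 :> R.
    by rewrite -exprS -[RHS]exprM mulnC exprM; congr (_ ^+ _); ring.
  by rewrite -exprMn exprVn.
move=> /le_trans; apply.
have m1 : m.+1%:R <= expR (16 * a).
  by rewrite -natr1 addrC (le_trans _ (expR_ge1Dx _)) // lerD2l.
have m9 : 9 ^+ m <= expR (144 * a).
  apply: (@le_trans _ _ (expR 9 ^+ m)).
    apply: lerXn2r; rewrite ?nnegrE ?expR_ge0 //.
    by rewrite (le_trans _ (expR_ge1Dx _)) // lerDr.
  rewrite -expRM_natr ler_expR; lra.
have a1 : 72 * a <= expR (72 * a).
  by rewrite (le_trans _ (expR_ge1Dx _)) // lerDr.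
have -> : 8 * (a * eps) * (9 * 9 ^+ m * m.+1%:R ^+ 2) =
  eps * ((72 * a) * (9 ^+ m * m.+1%:R ^+ 2)) by ring.
have -> : 248 * a = 72 * a + (144 * a + 16 * a * 2) by ring.
by rewrite !expRD expRM_natr !ler_pM ?mulr_ge0 ?exprn_ge0.
Qed.

(** * Construction of the junta *)

Section Approximation.
Variables (R : realType) (k l n : nat) (f : 'rV['Z_k]_n -> 'Z_l) (B : R).
Hypotheses (k2 : (2 <= k)%N) (l2 : (2 <= l)%N) (n0 : (0 < n)%N).
Hypothesis f_variation :
  \sum_(i < n) expect (fun z => cdist R (f z) (f (z + delta_mx 0 i))) <= B.

Definition splice_row (J : {set 'I_n}) (z w : 'rV['Z_k]_n) : 'rV['Z_k]_n :=
  \row_j if j \in J then z 0 j else w 0 j.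

(** Read through the encoding, [f] yields one Boolean function on the cube per half-circle. [J]
    keeps the coordinates whose block has a bit of influence above s^2 for some half-circle; each of
    them uses up s^2 of the total influence. *)
Lemma junta_approximation (d : nat) (s : R) : (0 < d)%N -> 0 < s ->
  exists (J : {set 'I_n}) (w : 'rV['Z_k]_n),
    #|J|%:R * s ^+ 2 <= 8 * k%:R * B /\
    expect (fun z => cdist R (f z) (f (splice_row J z w))) <=
      (d%:R^-1 + 3 ^+ d * s) * (8 * k%:R * B).
Proof.
(* Any N with 2 n k <= 2^N would do. *)
move=> d0 s0; pose N := (2 * n * k)%N.
have N_large : (2 * n * k <= 2 ^ N)%N by rewrite ltnW // ltn_expl.
pose F x := f (@encode k n N x).
pose Fr r x : R := (half_arc r (F x))%:R.
have Fr01 r x : (Fr r x == 0) || (Fr r x == 1).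
  by rewrite /Fr; case: half_arc; rewrite eqxx ?orbT.
have infl0 r j : 0 <= influence (Fr r) j.
  by apply: expect_ge0 => x; apply: sqr_ge0.
(* The constant 8 is 2 from the half-circle identity times 4 from the passage to the cube. *)
have tot_le : \sum_(j : 'I_n * 'I_N) \sum_r influence (Fr r) j <= 8 * k%:R * B.
  under eq_bigr => j _.
    rewrite /influence -expect_sum.
    under eq_expect do rewrite sum_half_arc_sqr //.
    rewrite expectZ; over.
  rewrite -mulr_sumr.
  have := total_cube_influence_le R k2 n0 N_large f l2.
  have := ler_wpM2l (_ : 0 <= 4 * k%:R) f_variation.
  move=> /(_ (mulr_ge0 (ler0n _ _) (ler0n _ _))) h1 h2.
  have := le_trans h2 h1; lra.
pose J := [set i | [exists b, exists r, s ^+ 2 < influence (Fr r) (i, b)]].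
pose J' := [set j : 'I_n * 'I_N | j.1 \in J].
have infJ r j : j \notin J' -> influence (Fr r) j <= s ^+ 2.
  case: j => i b; rewrite !inE /= negb_exists => /forallP/(_ b).
  by rewrite negb_exists => /forallP/(_ r); rewrite -leNgt.
(* [J'] consists of whole blocks, so splicing commutes with the encoding. *)
have spliceE x y : encode k (splice J' x y) = splice_row J (encode k x) (encode k y).
  apply/rowP => i; rewrite !mxE; case: ifP => iJ; congr (cell k _)%:R.
    by apply/ffunP => b; rewrite !ffunE inE /= iJ.
  by apply/ffunP => b; rewrite !ffunE inE /= iJ.
pose D (x y : {ffun 'I_n * 'I_N -> bool}) :=
  cdist R (F x) (f (splice_row J (encode k x) (encode k y))).
have var_le : expect (fun x => expect (D x)) <=
    (d%:R^-1 + 3 ^+ d * s) * (2 * k%:R * B).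
  have -> : expect (fun x => expect (D x)) =
    2^-1 * \sum_r expect (fun x =>
      expect (fun y => (Fr r x - Fr r (splice J' x y)) ^+ 2)).
    rewrite -expect_sum -expectZ; apply: eq_expect => x.
    rewrite -expect_sum -expectZ; apply: eq_expect => y.
    by rewrite sum_half_arc_sqr // /D /F spliceE mulKf // pnatr_eq0.
  have c0 : 0 <= d%:R^-1 + 3 ^+ d * s.
    apply: addr_ge0; last by apply: mulr_ge0 (ltW s0); apply: exprn_ge0.
    by rewrite invr_ge0.
  have : \sum_r
      4 * \sum_(S : {set 'I_n * 'I_N} | ~~ (S \subset J')) coef (Fr r) S ^+ 2
      <= (d%:R^-1 + 3 ^+ d * s) * (8 * k%:R * B).
    apply: le_trans (ler_wpM2l c0 tot_le).
    rewrite exchange_big mulr_sumr /=; apply: ler_sum => r _.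
    by apply: variance_off_influential => //; [exact: ltW | exact: infJ].
  (* The distance is half the splice variance, hence the Fourier mass outside [J'], a quarter of the
     quantity just bounded: 8 becomes 2. *)
  under [in X in _ -> X]eq_bigr do rewrite splice_variance.
  rewrite -!mulr_sumr; lra.
have D0 z w : 0 <= cdist R (f z) (f (splice_row J z w)) by exact: cdist_ge0.
have [w w_le] := exists_le_expect
  (fun w => expect (fun z => cdist R (f z) (f (splice_row J z w)))) 0.
exists J, w; split.
  apply: le_trans tot_le; rewrite mulr_natl -sumr_const.
  rewrite -(pair_bigA _ (fun i b => \sum_r influence (Fr r) (i, b))) /=.
  rewrite big_mkcond; apply: ler_sum => i _; rewrite inE.
  case: existsP => [[b /existsP[r lt_s]]|_]; last first.
    by apply: sumr_ge0 => b _; apply: sumr_ge0 => r _; apply: infl0.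
  rewrite (bigD1 b) //= (bigD1 r) //= -addrA (le_trans (ltW lt_s)) // lerDl.
  by rewrite addr_ge0 ?sumr_ge0 // => c _; rewrite sumr_ge0.
apply: (le_trans w_le); rewrite -exchange_expect.
(* Returning from the cube to the grid costs a factor 2 for each of the two points. *)
apply: (@le_trans _ _ (2 * (2 * ((d%:R^-1 + 3 ^+ d * s) * (2 * k%:R * B))))).
  apply: le_trans (expect_le_encode k2 n0 N_large _) _.
    by move=> z; apply: expect_ge0.
  rewrite ler_wpM2l //; apply: le_trans (ler_wpM2l _ var_le) => //.
  rewrite -expectZ; apply: ler_expect => x.
  exact: (expect_le_encode k2 n0 N_large (D0 (encode k x))).
by rewrite le_eqVlt; apply/orP; left; apply/eqP; ring.
Qed.

End Approximation.

Theorem theorem8 (R : realType) :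
  exists C2 : R, 0 < C2 /\
    forall (k l n : nat) (B : R) (f : 'rV['Z_k]_n -> 'Z_l),
      (2 <= k)%N -> (2 <= l)%N -> (1 <= n)%N -> 0 < B ->
      \sum_(j < n)
        mean (fun x => (cyc_abs (f x - f (x + delta_mx 0 j)))%:R) <= B ->
      forall eps : R, 0 < eps ->
      exists (M : nat) (g : 'rV['Z_k]_n -> 'Z_l),
        [/\ is_junta M g,
            eps_close eps f g
          & M%:R <= l%:R * expR (C2 * B * k%:R / eps)].
Proof.
exists 248; split=> // k l n B f k2 l2 n0 B0 f_var eps eps0.
have {}f_var :
    \sum_(i < n) expect (fun z => cdist R (f z) (f (z + delta_mx 0 i))) <= B.
  by under eq_bigr do rewrite -mean_expect //.
(* For eps >= l a constant is close enough; the final size estimate needs eps <= l. *)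
have [l_eps|eps_l] := leP l%:R eps.
  exists 0%N, (fun=> f 0); split.
  - by exists set0; rewrite cards0.
  - rewrite /eps_close mean_expect // (le_trans _ l_eps) //.
    rewrite -[leRHS](expect_cst (T := 'rV['Z_k]_n)).
      apply: ler_expect => z; rewrite ler_nat.
      exact: leq_trans (geq_minr _ _) (leq_subr _ _).
    by apply/card_gt0P; exists 0.
  - by rewrite mulr_ge0 ?expR_ge0.
pose a := B * k%:R / eps.
have a0 : 0 <= a by rewrite divr_ge0 ?mulr_ge0 // ltW.
have aE : a * eps = k%:R * B by rewrite /a mulfVK ?gt_eqF // mulrC.
(* With this [s], 3^d s = 1/d, so both error terms are equal and the error is 16 k B / d = 16 a eps
   / d; [d] is taken larger than 16 a to bring it below eps. *)
pose d := (Num.truncn (16 * a)).+1; pose s : R := (3 ^+ d * d%:R)^-1.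
have d0 : 0 < d%:R :> R by rewrite ltr0n.
have s0 : 0 < s by rewrite invr_gt0 mulr_gt0 ?exprn_gt0.
have [J [w [J_le close]]] :=
  junta_approximation k2 l2 n0 f_var (ltn0Sn _ : (0 < d)%N) s0.
exists #|J|, (fun z => f (splice_row J z w)); split.
- exists J; split=> // x y eq_xy; congr f; apply/rowP => j; rewrite !mxE.
  by case: ifP => // /eq_xy.
- rewrite /eps_close mean_expect // (le_trans close) //.
  have -> : 3 ^+ d * s = d%:R^-1 by rewrite /s invfM mulVKf ?expf_neq0 ?pnatr_eq0.
  have lt_ad : 16 * a < d%:R by exact: truncnS_gt.
  have -> : (d%:R^-1 + d%:R^-1) * (8 * k%:R * B) = 16 * (k%:R * B) / d%:R by ring.
  by rewrite -aE ler_pdivrMr // mulrA mulrC ler_wpM2l // ltW.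
rewrite (_ : 248 * B * k%:R / eps = 248 * a); last by rewrite /a !mulrA.
apply: (friedgut_constants (eps := eps) (d := d) (s := s)) => //.
  by rewrite !ltW.
by rewrite aE mulrA.
Qed.
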